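(* Let $N,M\ge2$ be integers, and let interpolation points $(x_i,y_j,z_{ij})\in\mathbb{R}^3$ ($0\le i\le N$, $0\le j\le M$) with $x_0<\dots<x_N$, $y_0<\dots<y_M$, arbitrary real numbers $s_{ij}$ with $|s_{ij}|<1$ ($0\le i\le N$, $0\le j\le M$), and domain points $x'_0,\dots,x'_N\in\{x_0,\dots,x_N\}$, $y'_0,\dots,y'_M\in\{y_0,\dots,y_M\}$ with $|x'_i-x'_{i-1}|>x_i-x_{i-1}$ for $1\le i\le N$ and $|y'_j-y'_{j-1}|>y_j-y_{j-1}$ for $1\le j\le M$ be given. Let $W_{ij}$ be the maps built from these data by bilinear interpolation as in the context. Then there exists a unique continuous function $f:[x_0,x_N]\times[y_0,y_M]\to\mathbb{R}$ such that $f(x_i,y_j)=z_{ij}$ for all $0\le i\le N$, $0\le j\le M$, and $\Gamma f|_{D_{ij}}=W_{ij}(\Gamma f|_{D'_{ij}})$ for all $1\le i\le N$, $1\le j\le M$. (This $f$ is called the bilinear recurrent fractal interpolation function, and its graph the bilinear recurrent fractal interpolation surface.)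
   Context: For $1\le i\le N$, $1\le j\le M$: $I_i=[x_{i-1},x_i]$, $J_j=[y_{j-1},y_j]$, $D_{ij}=I_i\times J_j$; $I'_i$ is the closed interval with endpoints $x'_{i-1},x'_i$, $J'_j$ the closed interval with endpoints $y'_{j-1},y'_j$, and $D'_{ij}=I'_i\times J'_j$. $u_i:I'_i\to I_i$ is the affine map with $u_i(x'_{i-1})=x_{i-1}$, $u_i(x'_i)=x_i$; $v_j:J'_j\to J_j$ is the affine map with $v_j(y'_{j-1})=y_{j-1}$, $v_j(y'_j)=y_j$. $z'_{ij}$ denotes the $z_{pq}$ with $x_p=x'_i$, $y_q=y'_j$. A function is bilinear if it has the form $a+bx+cy+dxy$. $g_{ij}:D'_{ij}\to\mathbb{R}$ is the bilinear function with $g_{ij}(x'_k,y'_\ell)=z'_{k\ell}$ for $(k,\ell)\in\{i-1,i\}\times\{j-1,j\}$. $h,S:[x_0,x_N]\times[y_0,y_M]\to\mathbb{R}$ are the functions that are bilinear on each $D_{ij}$ and satisfy $h(x_i,y_j)=z_{ij}$, $S(x_i,y_j)=s_{ij}$ for all $0\le i\le N$, $0\le j\le M$. For $(x,y)\in D'_{ij}$, $z\in\mathbb{R}$: $F_{ij}(x,y,z)=S(u_i(x),v_j(y))(z-g_{ij}(x,y))+h(u_i(x),v_j(y))$ and $W_{ij}(x,y,z)=(u_i(x),v_j(y),F_{ij}(x,y,z))$. For $E\subset[x_0,x_N]\times[y_0,y_M]$, $\Gamma f|_E=\{(x,y,f(x,y)):(x,y)\in E\}$. *)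

(* Defs.v *)
From HB Require Import structures.
From mathcomp Require Import all_boot all_order all_algebra.
From mathcomp Require Import all_classical all_reals all_analysis.
From mathcomp Require Import ring lra zify.

Set Implicit Arguments.
Unset Strict Implicit.
Unset Printing Implicit Defensive.

Import Order.TTheory GRing.Theory Num.Theory.
Import numFieldNormedType.Exports.

Local Open Scope classical_set_scope.
Local Open Scope ring_scope.

(* Conventions. Nodes and data are families indexed by nat, of which only the
   indices i <= N and j <= M are ever constrained or used. Cells are indexed
   by i < N and j < M, the cell (i, j) having corner nodes i, i.+1 and j, j.+1:
   the objects I_i, D_ij, u_i, g_ij, W_ij with 1 <= i <= N, 1 <= j <= M of the
   usual numbering are those with indices i.-1, j.-1 here. *)

(* The endpoints of this interval may come in either order. *)
Definition seg (R : realType) (a b : R) : set R :=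
  `[Num.min a b, Num.max a b].

Definition cell (R : realType) (x y : nat -> R) (i j : nat) : set (R * R) :=
  seg (x i) (x i.+1) `*` seg (y j) (y j.+1).

Definition affine_on (R : realType) (I : set R) (u : R -> R) : Prop :=
  exists a b : R, forall t, I t -> u t = a + b * t.

Definition bilinear_on (R : realType) (D : set (R * R)) (g : R * R -> R) : Prop :=
  exists a b c d : R, forall p, D p ->
    g p = a + b * p.1 + c * p.2 + d * p.1 * p.2.

Definition affine_map_between (R : realType) (a' b' a b : R) (u : R -> R) : Prop :=
  [/\ affine_on (seg a' b') u, u a' = a & u b' = b].

(* The value prescribed at the corner (x' k, y' l) is the datum z p q of the
   node (x p, y q) which coincides with that corner. *)
Definition domain_interpolant (R : realType) (N M : nat) (x y : nat -> R)
    (z : nat -> nat -> R) (x' y' : nat -> R) (i j : nat) (g : R * R -> R) : Prop :=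
  bilinear_on (cell x' y' i j) g /\
  forall k l p q, k \in [:: i; i.+1] -> l \in [:: j; j.+1] ->
    (p <= N)%N -> (q <= M)%N -> x p = x' k -> y q = y' l ->
    g (x' k, y' l) = z p q.

Definition pw_bilinear_interpolant (R : realType) (N M : nat) (x y : nat -> R)
    (w : nat -> nat -> R) (h : R * R -> R) : Prop :=
  (forall i j, (i < N)%N -> (j < M)%N -> bilinear_on (cell x y i j) h) /\
  (forall i j, (i <= N)%N -> (j <= M)%N -> h (x i, y j) = w i j).

Definition rfif_F (R : realType) (u v : R -> R) (g S h : R * R -> R)
    (p : R * R) (t : R) : R :=
  S (u p.1, v p.2) * (t - g p) + h (u p.1, v p.2).

Definition rfif_W (R : realType) (u v : R -> R) (g S h : R * R -> R)
    (q : R * R * R) : R * R * R :=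
  (u q.1.1, v q.1.2, rfif_F u v g S h q.1 q.2).

Definition graph_over (R : realType) (f : R * R -> R) (E : set (R * R)) :
    set (R * R * R) :=
  [set (p, f p) | p in E].

(* Functions with the properties above exist for all admissible data. *)

Lemma affine_map_between_exists (R : realType) (a' b' a b : R) :
  a' != b' -> exists u, affine_map_between a' b' a b u.
Proof.
move=> ab; have ab0 : b' - a' != 0 by rewrite subr_eq0 eq_sym.
exists (fun t => a + (b - a) / (b' - a') * (t - a')); split; try by field.
by exists (a - (b - a) / (b' - a') * a'), ((b - a) / (b' - a')) => t _; ring.
Qed.

Lemma domain_interpolant_exists (R : realType) (N M : nat) (x y : nat -> R)
    (z : nat -> nat -> R) (x' y' : nat -> R) (i j : nat) :
  {in [pred p | (p <= N)%N] &, injective x} ->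
  {in [pred q | (q <= M)%N] &, injective y} ->
  x' i != x' i.+1 -> y' j != y' j.+1 ->
  exists g, domain_interpolant N M x y z x' y' i j g.
Proof.
move=> xI yI nx ny.
have nx0 : x' i.+1 - x' i != 0 by rewrite subr_eq0 eq_sym.
have ny0 : y' j.+1 - y' j != 0 by rewrite subr_eq0 eq_sym.
have [zz zzE] : exists zz : nat -> nat -> R, forall k l p q,
    (p <= N)%N -> (q <= M)%N -> x p = x' k -> y q = y' l -> zz k l = z p q.
  have [zz zzP] : {zz : nat * nat -> R & forall kl p q, (p <= N)%N ->
      (q <= M)%N -> x p = x' kl.1 -> y q = y' kl.2 -> zz kl = z p q}.
    apply: (@choice _ _ (fun kl c => forall p q, (p <= N)%N ->
      (q <= M)%N -> x p = x' kl.1 -> y q = y' kl.2 -> c = z p q)) => -[k l] /=.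
    have [[[p q] [/= pN qM xp yq]]|no] := pselect (exists pq : nat * nat,
      [/\ (pq.1 <= N)%N, (pq.2 <= M)%N, x pq.1 = x' k & y pq.2 = y' l]).
      exists (z p q) => p1 q1 p1N q1M xp1 yq1.
      by congr z; [apply: xI | apply: yI] => //; congruence.
    by exists 0 => p q pN qM xp yq; case: no; exists (p, q).
  by exists (fun k l => zz (k, l)) => k l p q *; apply: zzP.
pose s t := (t - x' i) / (x' i.+1 - x' i).
pose r t := (t - y' j) / (y' j.+1 - y' j).
have s0 : s (x' i) = 0 by rewrite /s subrr mul0r.
have s1 : s (x' i.+1) = 1 by rewrite /s divff.
have r0 : r (y' j) = 0 by rewrite /r subrr mul0r.
have r1 : r (y' j.+1) = 1 by rewrite /r divff.
exists (fun p => zz i j * (1 - s p.1) * (1 - r p.2) +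
  zz i.+1 j * s p.1 * (1 - r p.2) + zz i j.+1 * (1 - s p.1) * r p.2 +
  zz i.+1 j.+1 * s p.1 * r p.2); split; last first.
  move=> k l p q; rewrite !inE => /orP[]/eqP-> /orP[]/eqP-> pN qM xp yq /=;
    rewrite -(zzE _ _ p q pN qM xp yq) ?s0 ?s1 ?r0 ?r1; ring.
set A := zz i j; set B := zz i.+1 j; set C := zz i j.+1; set E := zz i.+1 j.+1.
pose a := (x' i.+1 - x' i)^-1; pose b := (y' j.+1 - y' j)^-1.
pose cx := B - A; pose cy := C - A; pose cxy := A - B - C + E.
exists (A - cx * a * x' i - cy * b * y' j + cxy * a * b * x' i * y' j),
  (cx * a - cxy * a * b * y' j), (cy * b - cxy * a * b * x' i), (cxy * a * b).
move=> p _; rewrite /s /r -/a -/b /cx /cy /cxy; ring.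
Qed.

Lemma pw_affine_interpolant_exists (R : realType) (N : nat) (x c : nat -> R) :
  (forall i, (i < N)%N -> x i < x i.+1) ->
  exists f : R -> R,
    (forall i, (i < N)%N -> affine_on (seg (x i) (x i.+1)) f) /\
    (forall i, (i <= N)%N -> f (x i) = c i).
Proof.
elim: N => [_|N IH xlt].
  by exists (fun=> c 0%N); split=> // i; rewrite leqn0 => /eqP->.
have [i iN|f [fa fi]] := IH; first by apply: xlt; rewrite ltnS ltnW.
have xle i : (i <= N)%N -> x i <= x N.
  move=> iN; rewrite -(subnKC iN).
  have: (i + (N - i) <= N)%N by rewrite subnKC.
  elim: (N - i)%N => [|m IHm]; first by rewrite addn0.
  rewrite addnS => le; apply: le_trans (IHm (ltnW le)) _.
  by apply/ltW/xlt; rewrite ltnS ltnW.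
have xN := xlt N (ltnSn N).
have [g [[a [b ga]] gN gN1]] := @affine_map_between_exists R (x N) (x N.+1)
  (c N) (c N.+1) (negbT (lt_eqF xN)).
exists (fun t => if t <= x N then f t else g t); split=> i.
  rewrite ltnS leq_eqVlt => /predU1P[->|iN].
    exists a, b => t tI; case: ifP => [tN|_]; last exact: ga.
    have <- : x N = t.
      apply: le_anti; rewrite tN andbT; move: tI.
      by rewrite /seg /= in_itv /= (min_idPl (ltW xN)) => /andP[].
    rewrite fi // -gN ga // /seg /= in_itv /=.
    by rewrite ge_min lexx /= le_max lexx.
  have [a1 [b1 fab]] := fa i iN; exists a1, b1 => t tI.
  rewrite (fab t tI) ifT //; move: tI; rewrite /seg /= in_itv /= => /andP[_].
  move/le_trans; apply; rewrite ge_max !xle //; exact: ltnW.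
rewrite leq_eqVlt => /predU1P[->|]; first by rewrite leNgt xN.
by rewrite ltnS => iN; rewrite xle // fi.
Qed.

Lemma pw_bilinear_interpolant_exists (R : realType) (N M : nat)
    (x y : nat -> R) (w : nat -> nat -> R) :
  (forall i, (i < N)%N -> x i < x i.+1) ->
  (forall j, (j < M)%N -> y j < y j.+1) ->
  exists h, pw_bilinear_interpolant N M x y w h.
Proof.
move=> xlt ylt.
have [phi phiP] := choice (fun k : nat =>
  pw_affine_interpolant_exists (fun i => (i == k)%:R) xlt).
have [psi psiP] := choice (fun k : nat =>
  pw_affine_interpolant_exists (fun j => w k j) ylt).
exists (fun p => \sum_(k < N.+1) phi k p.1 * psi k p.2); split=> i j iN jM.
  elim: (N.+1) => [|n [a [b [c [d IH]]]]].
    by exists 0, 0, 0, 0 => p _; rewrite big_ord0; ring.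
  have [a1 [b1 phiE]] := (phiP n).1 i iN.
  have [a2 [b2 psiE]] := (psiP n).1 j jM.
  exists (a + a1 * a2), (b + b1 * a2), (c + a1 * b2), (d + b1 * b2) => p pD.
  rewrite big_ord_recr /= IH // phiE; last by case: pD.
  by rewrite psiE; [ring | case: pD].
rewrite (bigD1 (Ordinal (n := N.+1) iN)) //= big1 ?addr0; last first.
  move=> k; rewrite -val_eqE /= => ki.
  by rewrite (phiP k).2 // eq_sym (negbTE ki) mul0r.
by rewrite (phiP i).2 // eqxx mul1r (psiP i).2.
Qed.

(* Main.v *)
Require Import Defs.
From HB Require Import structures.
From mathcomp Require Import all_boot all_order all_algebra.
From mathcomp Require Import all_classical all_reals all_analysis.
From mathcomp Require Import ring lra.

Set Implicit Arguments.
Unset Strict Implicit.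
Unset Printing Implicit Defensive.

Import Order.TTheory GRing.Theory Num.Theory.
Import numFieldNormedType.Exports.

Local Open Scope classical_set_scope.
Local Open Scope ring_scope.

(** Since h, S are bilinear on cells and u_i, v_j map the end points of I'_i,
    J'_j to those of I_i, J_j, the piecewise affine maps L, K with L(x_i) = x'_i,
    K(y_j) = y'_j invert all the u_i, v_j simultaneously, and the piecewise
    bilinear G with G(x_i, y_j) = z'_ij satisfies G(u_i(a), v_j(b)) = g_ij(a, b).
    With Phi = (L, K), which maps the rectangle continuously to itself, the
    graph equations thus amount to the single functional equation
      f = S (f o Phi - G) + h,
    where |S| <= max |s_ij| < 1.  The right-hand side is a contraction of the
    space of continuous functions.  A bounded d with d = S (d o Phi) on a
    Phi-stable set vanishes there; for f' - f on the rectangle this gives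
    uniqueness, and for f - h on the set of nodes the interpolation property. *)

(** * Segments, affine and bilinear functions in barycentric coordinates *)

(** Describing a point by its ratio [t] along the segment makes the order of the endpoints
    irrelevant; this matters for [x'] and [y'], which need not be increasing. *)
Lemma seg_line_pathP (R : realType) (a b p : R) :
  seg a b p <-> exists2 t, 0 <= t <= 1 & p = line_path a b t.
Proof.
rewrite /seg /line_path /= in_itv /=; split=> [|[t t01 ->]]; last first.
  by rewrite ge_min le_max; case: (lerP a b) => ab; apply/andP; split;
    apply/orP; nra.
have [<-|ab] := eqVneq a b.
  rewrite minxx maxxx => /le_anti <-.
  by exists 0; [rewrite lexx ler01 | ring].
have ba0 : b - a != 0 by rewrite subr_eq0 eq_sym.
move=> pab; exists ((p - a) / (b - a)); last by field.
have [ltab|ltba|/eqP] := ltgtP a b; last by rewrite (negbTE ab).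
  rewrite ler_pdivlMr ?subr_gt0 // ler_pdivrMr ?subr_gt0 //.
  by move: pab; rewrite (min_idPl (ltW ltab)) (max_idPr (ltW ltab)); lra.
rewrite ler_ndivlMr ?subr_lt0 // ler_ndivrMr ?subr_lt0 //.
by move: pab; rewrite (min_idPr (ltW ltba)) (max_idPl (ltW ltba)); lra.
Qed.

Lemma seg_line_path (R : realType) (a b t : R) :
  0 <= t <= 1 -> seg a b (line_path a b t).
Proof. by move=> t01; apply/seg_line_pathP; exists t. Qed.

Lemma seg_endl (R : realType) (a b : R) : seg a b a.
Proof. by apply/seg_line_pathP; exists 0; rewrite ?line_path0 ?lexx ?ler01. Qed.

Lemma seg_endr (R : realType) (a b : R) : seg a b b.
Proof. by apply/seg_line_pathP; exists 1; rewrite ?line_path1 ?lexx ?ler01. Qed.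

Lemma segS (R : realType) (a b c d : R) :
  c <= a <= d -> c <= b <= d -> seg a b `<=` `[c, d].
Proof.
move=> /andP[ca ad] /andP[cb bd] p; rewrite /seg /= !in_itv /= => /andP[ap pb].
apply/andP; split; [apply: le_trans ap | apply: le_trans pb _].
  by rewrite le_min ca cb.
by rewrite ge_max ad bd.
Qed.

Lemma affine_on_line_path (R : realType) (f : R -> R) (a b t : R) :
  affine_on (seg a b) f -> 0 <= t <= 1 ->
  f (line_path a b t) = line_path (f a) (f b) t.
Proof.
move=> [m [n fE]] t01; rewrite !fE; first by rewrite /line_path; ring.
- exact: seg_endr.
- exact: seg_endl.
- exact: seg_line_path.
Qed.

(** A bilinear function stays bilinear in the ratios [t], [r], so its corner values determine it.
    Two functions on different cells can thus be compared through their corners alone. *)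
Lemma bilinear_on_line_path (R : realType) (f : R * R -> R) (a b c d t r : R) :
  bilinear_on (seg a b `*` seg c d) f -> 0 <= t <= 1 -> 0 <= r <= 1 ->
  f (line_path a b t, line_path c d r) =
  line_path (line_path (f (a, c)) (f (b, c)) t)
            (line_path (f (a, d)) (f (b, d)) t) r.
Proof.
move=> [k [l [m [n fE]]]] t01 r01; rewrite !fE /=; first by rewrite /line_path; ring.
all: by split=> /=; (exact: seg_endr || exact: seg_endl || exact: seg_line_path).
Qed.

Lemma ler_norm_line_path (R : realType) (a b t B : R) :
  0 <= t <= 1 -> `|a| <= B -> `|b| <= B -> `|line_path a b t| <= B.
Proof. by rewrite /line_path !ler_norml => *; apply/andP; split; nra. Qed.

(** * Continuity relative to a subset *)

Lemma bilinear_on_continuous (R : realType) (D : set (R * R)) (f : R * R -> R) :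
  bilinear_on D f -> {within D, continuous f}.
Proof.
move=> [a [b [c [d fE]]]].
apply: (@subspace_eq_continuous _ _ _
  (fun p : R * R => a + b * p.1 + c * p.2 + d * p.1 * p.2)).
  by move=> p /set_mem /fE.
apply: continuous_subspaceT => p.
have c1 : (fun p : R * R => p.1) @ p --> p.1 by exact: cvg_fst.
have c2 : (fun p : R * R => p.2) @ p --> p.2 by exact: cvg_snd.
apply: cvgD; last by apply: cvgM => //; apply: cvgM => //; exact: cvg_cst.
apply: cvgD; last by apply: cvgM => //; exact: cvg_cst.
by apply: cvgD; [exact: cvg_cst|apply: cvgM => //; exact: cvg_cst].
Qed.

Lemma within_continuous_comp_to (T U V : topologicalType) (A : set T) (B : set U)
    (f : T -> U) (g : U -> V) :
  (forall p, A p -> B (f p)) ->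
  {within A, continuous f} -> {within B, continuous g} ->
  {within A, continuous (g \o f)}.
Proof.
move=> fAB /subspace_continuousP cf /subspace_continuousP cg.
apply/subspace_continuousP => p Ap.
apply: (@cvg_comp _ _ _ f g _ (within B (nbhs (f p)))); last exact: cg (fAB _ Ap).
move=> W BW; have := cf p Ap _ BW; rewrite !nbhs_simpl /= /within /=.
by apply: filterS => w Ww Aw; apply: Ww => //; exact: fAB.
Qed.

Lemma within_continuousD (T : topologicalType) (R : realType) (A : set T)
    (f g : T -> R) :
  {within A, continuous f} -> {within A, continuous g} ->
  {within A, continuous (fun p => f p + g p)}.
Proof.
move=> /subspace_continuousP cf /subspace_continuousP cg.
by apply/subspace_continuousP => p Ap; apply: cvgD; [exact: cf|exact: cg].
Qed.

Lemma within_continuousM (T : topologicalType) (R : realType) (A : set T)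
    (f g : T -> R) :
  {within A, continuous f} -> {within A, continuous g} ->
  {within A, continuous (fun p => f p * g p)}.
Proof.
move=> /subspace_continuousP cf /subspace_continuousP cg.
by apply/subspace_continuousP => p Ap; apply: cvgM; [exact: cf|exact: cg].
Qed.

Lemma within_continuousB (T : topologicalType) (R : realType) (A : set T)
    (f g : T -> R) :
  {within A, continuous f} -> {within A, continuous g} ->
  {within A, continuous (fun p => f p - g p)}.
Proof.
move=> /subspace_continuousP cf /subspace_continuousP cg.
by apply/subspace_continuousP => p Ap; apply: cvgB; [exact: cf|exact: cg].
Qed.

Lemma within_continuous_pair (T U V : topologicalType) (A : set T)
    (f : T -> U) (g : T -> V) :
  {within A, continuous f} -> {within A, continuous g} ->
  {within A, continuous (fun p => (f p, g p))}.
Proof.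
move=> /subspace_continuousP cf /subspace_continuousP cg.
by apply/subspace_continuousP => p Ap; apply: cvg_pair; [exact: cf|exact: cg].
Qed.

Lemma within_continuous_bounded (T : topologicalType) (R : realType) (A : set T)
    (f : T -> R) : compact A -> {within A, continuous f} ->
  exists B, forall p, A p -> `|f p| <= B.
Proof.
move=> cA cf; have [B [_ fB]] := compact_bounded (continuous_compact cf cA).
exists (B + 1) => p Ap; apply: (fB (B + 1)); first by rewrite ltrDl.
by exists p.
Qed.

(** This is the pasting lemma for a finite closed cover. The induction carries closedness along with
    continuity, since pasting two pieces requires both to be closed. *)
Lemma within_continuous_closed_cover (T U : topologicalType) (I : finType)
    (D : I -> set T) (A : set T) (f : T -> U) :
  (forall i, closed (D i)) -> (forall i, {within D i, continuous f}) ->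
  A `<=` \bigcup_i D i -> {within A, continuous f}.
Proof.
move=> Dc fD AD; apply: (@continuous_subspaceW _ _ _ (\big[setU/set0]_i D i)).
  move=> p /AD[i _ Dp]; rewrite (bigD1 i) //=; by left.
suff [] : closed (\big[setU/set0]_i D i) /\
  {within \big[setU/set0]_i D i, continuous f} by [].
elim/big_ind: _ => [|B C [Bc fB] [Cc fC]|i _]; last by split.
- by split; [exact: closed0|exact: continuous_subspace0].
- by split; [exact: closedU|exact: withinU_continuous].
Qed.

(** * The equation [f = S * (f \o Phi) + q] with [|S| <= sigma < 1] *)

(** Iterating the equation [n] times gives [|d| <= B * sigma ^+ n] on [A], which tends to [0]. No
    topology on [A] enters, so the set may be the rectangle or the set of nodes. *)
Lemma cocycle_bounded_eq0 (T : Type) (R : realType) (A : set T) (Phi : T -> T)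
    (S d : T -> R) (sigma B : R) :
  0 <= sigma < 1 -> (forall p, A p -> A (Phi p)) ->
  (forall p, A p -> `|S p| <= sigma) -> (forall p, A p -> `|d p| <= B) ->
  (forall p, A p -> d p = S p * d (Phi p)) ->
  forall p, A p -> d p = 0.
Proof.
move=> /andP[s0 s1] APhi Ss dB dE p Ap.
have dn n : forall p, A p -> `|d p| <= B * sigma ^+ n.
  elim: n => [|n IH] {Ap}p Ap; first by rewrite expr0 mulr1 dB.
  by rewrite dE // normrM exprS mulrCA ler_pM ?Ss ?IH //; exact: APhi.
apply/normr0_eq0/le_anti; rewrite normr_ge0 andbT.
have /cvg_lim <- // : geometric B sigma @ \oo --> (0 : R).
  by apply: cvg_geometric; rewrite ger0_norm.
apply: limr_ge.
  by apply/cvg_ex; exists 0; apply: cvg_geometric; rewrite ger0_norm.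
by apply: nearW => n; exact: dn.
Qed.

(** Picard iteration from [0] converges uniformly on [A] at a geometric rate, so the limit inherits
    continuity and solves the equation. *)
Lemma cocycle_fixpoint (T : topologicalType) (R : realType) (A : set T)
    (Phi : T -> T) (S q : T -> R) (sigma B : R) :
  0 <= sigma < 1 -> (forall p, A p -> A (Phi p)) ->
  {within A, continuous Phi} -> {within A, continuous S} ->
  {within A, continuous q} ->
  (forall p, A p -> `|S p| <= sigma) -> (forall p, A p -> `|q p| <= B) ->
  exists f : T -> R, {within A, continuous f} /\
    forall p, A p -> f p = S p * f (Phi p) + q p.
Proof.
move=> /andP[s0 s1] APhi cPhi cS cq Ss qB.
pose F := fix F n p := if n is n'.+1 then S p * F n' (Phi p) + q p else 0.
(* [C] solves [C = sigma * C + B], so the bound [C] is preserved by each iteration. *)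
pose C := B / (1 - sigma).
have s10 : 1 - sigma != 0 by rewrite subr_eq0 gt_eqF.
have cF n : {within A, continuous (F n)}.
  elim: n => [|n IH] /=; first by apply: continuous_subspaceT => p; exact: cvg_cst.
  apply: within_continuousD => //; apply: within_continuousM => //.
  exact: within_continuous_comp_to APhi cPhi IH.
have FC k : forall p, A p -> `|F k p| <= C.
  elim: k => [|k IH] p Ap /=.
    rewrite normr0; apply: divr_ge0; last by rewrite subr_ge0 ltW.
    (* The point [p] of [A] forces [0 <= B]. *)
    by apply: le_trans (qB p Ap).
  have -> : C = sigma * C + B by rewrite /C; field.
  apply: (le_trans (ler_normD _ _)); apply: lerD; last exact: qB.
  by rewrite normrM ler_pM ?Ss ?IH //; exact: APhi.
(* Each iteration cancels [q] in the difference and contributes one factor [S]; after [n] of them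
   there remains [F k - F 0 = F k], bounded by [C]. *)
have FF n k : forall p, A p -> `|F (n + k)%N p - F n p| <= C * sigma ^+ n.
  elim: n => [|n IH] p Ap; first by rewrite subr0 expr0 mulr1 FC.
  rewrite /= opprD addrACA subrr addr0 -mulrBr normrM exprS mulrCA.
  by rewrite ler_pM ?Ss ?IH //; exact: APhi.
have geo : geometric C sigma @ \oo --> (0 : R).
  by apply: cvg_geometric; rewrite ger0_norm.
have geos (e : R) : 0 < e -> \forall n \near \oo, C * sigma ^+ n < e.
  by move=> e0; apply: (cvgr_lt _ geo).
have Fcvg p : A p -> cvg (F n p @[n --> \oo]).
  move=> Ap; apply/cauchy_cvgP/cauchy_exP => e e0.
  have [n _ /(_ n (leqnn n)) Cn] := geos e e0.
  exists (F n p); exists n => // m /= nm.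
  by rewrite /ball /= distrC -(subnKC nm) (le_lt_trans (FF _ _ _ Ap)).
pose f p : R := lim (F n p @[n --> \oo]).
(* This is [FF] in the limit [k] to infinity. *)
have fF n p : A p -> `|f p - F n p| <= C * sigma ^+ n.
  move=> Ap.
  have cn : `|F m p - F n p| @[m --> \oo] --> `|f p - F n p|.
    by apply: cvg_norm; apply: cvgB; [exact: Fcvg|exact: cvg_cst].
  rewrite -(cvg_lim _ cn) //; apply: limr_le; first by apply/cvg_ex; exists `|f p - F n p|.
  by exists n => // m /= nm; rewrite -(subnKC nm) FF.
exists f; split; last first.
  move=> p Ap; apply: cvg_lim => //.
  (* The shifted sequence has the same limit, and its terms unfold to [S p * F n (Phi p) + q p]. *)
  rewrite -(cvg_shiftS (fun n => F n p)) /=.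
  apply: cvgD; last exact: cvg_cst.
  by apply: cvgM; [exact: cvg_cst|apply: Fcvg; exact: APhi].
(* The bound in [fF] does not depend on [p], so the convergence is uniform on [A]. *)
apply: (@uniform_limit_continuous_subspace _ _ _ (F n @[n --> \oo])).
  by exists 0%N => // n _; exact: cF.
move=> P /uniform_nbhs[E []]; rewrite -entourage_ballE => -[e /= e0 eE] EP.
have := geos e e0; rewrite nbhs_simpl /=; apply: filterS => n Cn.
by apply: EP => p Ap; apply: eE => /=; rewrite /ball /= (le_lt_trans (fF _ _ Ap)).
Qed.

(** * The grid: ordered nodes, covering by cells, bounds on the data *)

Lemma incr_nodes_itv (R : realType) (N : nat) (x : nat -> R) (i : nat) :
  (forall k, (k < N)%N -> x k < x k.+1) -> (i <= N)%N -> x 0%N <= x i <= x N.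
Proof.
move=> xlt iN.
have xle k l : (k <= l)%N -> (l <= N)%N -> x k <= x l.
  elim: l => [|l IH]; first by rewrite leqn0 => /eqP->.
  rewrite leq_eqVlt => /predU1P[->//|]; rewrite ltnS => kl lN.
  by apply: le_trans (IH kl (ltnW lN)) _; apply/ltW/xlt.
by rewrite !xle.
Qed.

Lemma seg_cover (R : realType) (N : nat) (x : nat -> R) (t : R) :
  (forall k, (k < N)%N -> x k < x k.+1) -> (0 < N)%N -> x 0%N <= t <= x N ->
  exists2 i, (i < N)%N & seg (x i) (x i.+1) t.
Proof.
elim: N => // N IH xlt _ /andP[t0 tN].
have [tN'|tN'] := lerP (x N) t.
  exists N => //; rewrite /seg /= in_itv /= ge_min tN' le_max tN orbT //.
(* For [N = 0] the bounds would read [x 0 <= t < x 0]. *)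
have N0 : (0 < N)%N by case: N tN' {IH xlt tN} => //; rewrite ltNge t0.
have [||i iN ti] := IH _ N0; last by exists i; rewrite // ltnW.
  by move=> k kN; apply: xlt; rewrite ltnW.
by rewrite t0 ltW.
Qed.

Lemma cell_closed (R : realType) (x y : nat -> R) (i j : nat) :
  closed (cell x y i j).
Proof.
apply: compact_closed; first exact: norm_hausdorff.
by apply: compact_setX; exact: segment_compact.
Qed.

(** The finitely many closed cells cover the rectangle, and [f] is one function on the plane, so no
    agreement along common edges has to be checked. *)
Lemma pw_bilinear_continuous (R : realType) (N M : nat) (x y : nat -> R)
    (f : R * R -> R) :
  (0 < N)%N -> (0 < M)%N ->
  (forall i, (i < N)%N -> x i < x i.+1) ->
  (forall j, (j < M)%N -> y j < y j.+1) ->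
  (forall i j, (i < N)%N -> (j < M)%N -> bilinear_on (cell x y i j) f) ->
  {within `[x 0%N, x N] `*` `[y 0%N, y M], continuous f}.
Proof.
move=> N0 M0 xlt ylt fb.
apply: (@within_continuous_closed_cover _ _ ('I_N * 'I_M)%type
  (fun ij => cell x y ij.1 ij.2)).
- by move=> ij; exact: cell_closed.
- by move=> ij; apply: bilinear_on_continuous; exact: fb.
- move=> p [/= p1 p2]; rewrite !in_itv /= in p1 p2.
  have [i iN xi] := seg_cover xlt N0 p1.
  have [j jM yj] := seg_cover ylt M0 p2.
  by exists (Ordinal iN, Ordinal jM).
Qed.

Lemma uniform_bound_lt1 (R : realType) (N M : nat) (s : nat -> nat -> R) :
  (forall i j, (i <= N)%N -> (j <= M)%N -> `|s i j| < 1) ->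
  exists2 sigma, 0 <= sigma < 1 &
    forall i j, (i <= N)%N -> (j <= M)%N -> `|s i j| <= sigma.
Proof.
move=> s1.
pose m := \big[Num.max/0]_(ij : 'I_N.+1 * 'I_M.+1) `|s ij.1 ij.2|.
have sm i j : (i <= N)%N -> (j <= M)%N -> `|s i j| <= m.
  move=> iN jM; exact: (le_bigmax 0 (fun ij : 'I_N.+1 * 'I_M.+1 => `|s ij.1 ij.2|)
    (Ordinal (n := N.+1) iN, Ordinal (n := M.+1) jM)).
exists m => //; apply/andP; split.
  by apply: le_trans (sm 0%N 0%N _ _).
apply: bigmax_lt => // -[i j] _ /=; apply: s1; by rewrite -ltnS.
Qed.

(** * Existence and uniqueness of the fractal interpolation function *)

Theorem mainTheorem3 (R : realType) (N M : nat)
    (x y : nat -> R) (z s : nat -> nat -> R) (x' y' : nat -> R)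
    (u v : nat -> R -> R) (g : nat -> nat -> R * R -> R) (S h : R * R -> R)
    (N_ge2 : (2 <= N)%N) (M_ge2 : (2 <= M)%N)
    (x_incr : forall i, (i < N)%N -> x i < x i.+1)
    (y_incr : forall j, (j < M)%N -> y j < y j.+1)
    (s_lt1 : forall i j, (i <= N)%N -> (j <= M)%N -> `|s i j| < 1)
    (x'_node : forall i, (i <= N)%N -> exists2 p, (p <= N)%N & x' i = x p)
    (y'_node : forall j, (j <= M)%N -> exists2 q, (q <= M)%N & y' j = y q)
    (x'_gap : forall i, (i < N)%N -> x i.+1 - x i < `|x' i.+1 - x' i|)
    (y'_gap : forall j, (j < M)%N -> y j.+1 - y j < `|y' j.+1 - y' j|)
    (u_affine : forall i, (i < N)%N ->
      affine_map_between (x' i) (x' i.+1) (x i) (x i.+1) (u i))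
    (v_affine : forall j, (j < M)%N ->
      affine_map_between (y' j) (y' j.+1) (y j) (y j.+1) (v j))
    (g_bilinear : forall i j, (i < N)%N -> (j < M)%N ->
      domain_interpolant N M x y z x' y' i j (g i j))
    (h_bilinear : pw_bilinear_interpolant N M x y z h)
    (S_bilinear : pw_bilinear_interpolant N M x y s S) :
  let rect : set (R * R) := `[x 0%N, x N] `*` `[y 0%N, y M] in
  let is_rfif (f : R * R -> R) : Prop :=
    [/\ {within rect, continuous f},
        forall i j, (i <= N)%N -> (j <= M)%N -> f (x i, y j) = z i j
      & forall i j, (i < N)%N -> (j < M)%N ->
          graph_over f (cell x y i j) =
          rfif_W (u i) (v j) (g i j) S h @` graph_over f (cell x' y' i j)] in
  exists f : R * R -> R,
    is_rfif f /\
    forall f' : R * R -> R, is_rfif f' -> forall p, rect p -> f' p = f p.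
Proof.
move=> rect is_rfif.
have N0 : (0 < N)%N by exact: ltnW.
have M0 : (0 < M)%N by exact: ltnW.
have [hb hxy] := h_bilinear; have [Sb Sxy] := S_bilinear.
have xI i : (i <= N)%N -> x 0%N <= x i <= x N by exact: incr_nodes_itv.
have yI j : (j <= M)%N -> y 0%N <= y j <= y M by exact: incr_nodes_itv.
have x'I i : (i <= N)%N -> x 0%N <= x' i <= x N by move=> /x'_node[p /xI ? ->].
have y'I j : (j <= M)%N -> y 0%N <= y' j <= y M by move=> /y'_node[q /yI ? ->].
have [L [La Lx]] := pw_affine_interpolant_exists x' x_incr.
have [K [Ka Ky]] := pw_affine_interpolant_exists y' y_incr.
(* The corner value [z'_ij] is written as [h (x' i, y' j)]: since [(x' i, y' j)] is a node and [h]
   interpolates [z], this avoids choosing its indices. *)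
have [G [Gb Gxy]] :=
  pw_bilinear_interpolant_exists (fun i j => h (x' i, y' j)) x_incr y_incr.
pose Phi (p : R * R) := (L p.1, K p.2).
(* The pair [(t, r)] serves as common coordinates on the cells [D_ij] and [D'_ij]; in them [Phi] and
   the [(u i, v j)] become the identity. *)
pose P i j t r := (line_path (x i) (x i.+1) t, line_path (y j) (y j.+1) r).
pose P' i j t r := (line_path (x' i) (x' i.+1) t, line_path (y' j) (y' j.+1) r).
have rectP p : rect p -> exists i j t r, [/\ (i < N)%N, (j < M)%N,
    0 <= t <= 1, 0 <= r <= 1 & p = P i j t r].
  case: p => p1 p2 [/=]; rewrite !in_itv /= => p1I p2I.
  have [i iN /seg_line_pathP[t t01 ->]] := seg_cover x_incr N0 p1I.
  have [j jM /seg_line_pathP[r r01 ->]] := seg_cover y_incr M0 p2I.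
  by exists i, j, t, r.
have rect_P i j t r : (i < N)%N -> (j < M)%N -> 0 <= t <= 1 -> 0 <= r <= 1 ->
    rect (P i j t r).
  move=> iN jM t01 r01; split=> /=.
    by apply: (segS (xI i (ltnW iN)) (xI _ iN)); exact: seg_line_path.
  by apply: (segS (yI j (ltnW jM)) (yI _ jM)); exact: seg_line_path.
have rect_P' i j t r : (i < N)%N -> (j < M)%N -> 0 <= t <= 1 -> 0 <= r <= 1 ->
    rect (P' i j t r).
  move=> iN jM t01 r01; split=> /=.
    by apply: (segS (x'I i (ltnW iN)) (x'I _ iN)); exact: seg_line_path.
  by apply: (segS (y'I j (ltnW jM)) (y'I _ jM)); exact: seg_line_path.
have PhiP i j t r : (i < N)%N -> (j < M)%N -> 0 <= t <= 1 -> 0 <= r <= 1 ->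
    Phi (P i j t r) = P' i j t r.
  move=> iN jM t01 r01; rewrite /Phi /P /P' /=.
  rewrite (affine_on_line_path (La i iN)) // (affine_on_line_path (Ka j jM)) //.
  by rewrite !Lx ?(ltnW iN) // !Ky ?(ltnW jM).
have rect_Phi p : rect p -> rect (Phi p).
  by move=> /rectP[i [j [t [r [iN jM t01 r01 ->]]]]]; rewrite PhiP //; exact: rect_P'.
have uvP i j t r : (i < N)%N -> (j < M)%N -> 0 <= t <= 1 -> 0 <= r <= 1 ->
    (u i (P' i j t r).1, v j (P' i j t r).2) = P i j t r.
  move=> iN jM t01 r01; have [ua u0 u1] := u_affine i iN.
  have [va v0 v1] := v_affine j jM; rewrite /P /P' /=.
  by rewrite (affine_on_line_path ua) // (affine_on_line_path va) // u0 u1 v0 v1.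
have gh i j k l : (i < N)%N -> (j < M)%N -> k \in [:: i; i.+1] ->
    l \in [:: j; j.+1] -> g i j (x' k, y' l) = h (x' k, y' l).
  move=> iN jM ki lj.
  have kN : (k <= N)%N by move: ki; rewrite !inE => /orP[]/eqP->; rewrite // ltnW.
  have lM : (l <= M)%N by move: lj; rewrite !inE => /orP[]/eqP->; rewrite // ltnW.
  have [p pN xp] := x'_node k kN; have [q qM yq] := y'_node l lM.
  by rewrite ((g_bilinear i j iN jM).2 k l p q) // xp yq hxy.
(* Both sides are bilinear in [(t, r)] and, by [gh], agree at the four corners. *)
have GP i j t r : (i < N)%N -> (j < M)%N -> 0 <= t <= 1 -> 0 <= r <= 1 ->
    G (P i j t r) = g i j (P' i j t r).
  move=> iN jM t01 r01; rewrite /P /P' (bilinear_on_line_path (Gb i j iN jM)) //.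
  rewrite (bilinear_on_line_path (g_bilinear i j iN jM).1) //.
  by rewrite !Gxy ?gh ?inE ?eqxx ?orbT // ltnW.
have functional f : (forall i j, (i < N)%N -> (j < M)%N ->
      graph_over f (cell x y i j) =
      rfif_W (u i) (v j) (g i j) S h @` graph_over f (cell x' y' i j)) <->
    (forall p, rect p -> f p = S p * (f (Phi p) - G p) + h p).
  (* The graph point over [P'] is sent to the point over [P] whose height is the right-hand side of
     the functional equation. *)
  have WP i j t r : (i < N)%N -> (j < M)%N -> 0 <= t <= 1 -> 0 <= r <= 1 ->
      rfif_W (u i) (v j) (g i j) S h (P' i j t r, f (P' i j t r)) =
      (P i j t r, S (P i j t r) * (f (Phi (P i j t r)) - G (P i j t r)) + h (P i j t r)).
    by move=> iN jM t01 r01; rewrite /rfif_W /rfif_F !uvP // PhiP // GP.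
  split=> [fW p /rectP[i [j [t [r [iN jM t01 r01 ->]]]]]|fE i j iN jM].
    have : graph_over f (cell x y i j)
        (rfif_W (u i) (v j) (g i j) S h (P' i j t r, f (P' i j t r))).
      rewrite fW //; exists (P' i j t r, f (P' i j t r)) => //.
      by exists (P' i j t r) => //; split; exact: seg_line_path.
    by rewrite WP // => -[q _ [-> ->]].
  apply/seteqP; split=> [_ [[p1 p2] [/= + +] <-]|_ [_ [[p1 p2] [/= + +] <-] <-]].
    move=> /seg_line_pathP[t t01 ->] /seg_line_pathP[r r01 ->].
    exists (P' i j t r, f (P' i j t r)).
      by exists (P' i j t r) => //; split; exact: seg_line_path.
    by rewrite WP // -fE //; exact: rect_P.
  move=> /seg_line_pathP[t t01 ->] /seg_line_pathP[r r01 ->].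
  rewrite -/(P' i j t r) WP // -fE; last exact: rect_P.
  by exists (P i j t r) => //; split; exact: seg_line_path.
have [sigma sigma01 ssigma] := uniform_bound_lt1 s_lt1.
have Ssigma p : rect p -> `|S p| <= sigma.
  move=> /rectP[i [j [t [r [iN jM t01 r01 ->]]]]].
  (* On a cell, [S] is an iterated convex combination of four values [s], so it obeys their common
     bound. *)
  rewrite /P (bilinear_on_line_path (Sb i j iN jM)) // !Sxy ?(ltnW iN) ?(ltnW jM) //.
  by do !apply: ler_norm_line_path => //; apply: ssigma => //; exact: ltnW.
have cont := pw_bilinear_continuous N0 M0 x_incr y_incr.
have cS := cont _ Sb; have ch := cont _ hb; have cG := cont _ Gb.
have cPhi : {within rect, continuous Phi}.
  (* Each component of [Phi] depends affinely on one variable on each cell, hence is bilinear there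
     with the other coefficients zero. *)
  apply: within_continuous_pair; apply: cont => i j iN jM.
    have [a [b Lab]] := La i iN.
    by exists a, b, 0, 0 => p [p1 _]; rewrite Lab //; ring.
  have [a [b Kab]] := Ka j jM.
  by exists a, 0, b, 0 => p [_ p2]; rewrite Kab //; ring.
have rect_compact : compact rect by apply: compact_setX; exact: segment_compact.
(* [h - S * G] is the inhomogeneous term once the product in the functional equation is expanded. *)
have cq : {within rect, continuous (fun p => h p - S p * G p)}.
  by apply: within_continuousB => //; exact: within_continuousM.
have [B qB] := within_continuous_bounded rect_compact cq.
have [f [cf fE]] := cocycle_fixpoint sigma01 rect_Phi cPhi cS cq Ssigma qB.
have fF p : rect p -> f p = S p * (f (Phi p) - G p) + h p.
  by move=> /fE->; ring.
have rect_node i j : (i <= N)%N -> (j <= M)%N -> rect (x i, y j).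
  by move=> iN jM; split; rewrite /= in_itv /= ?xI ?yI.
exists f; split; [split=> //; last exact/functional | ].
  (* [Phi] maps nodes to nodes because the [x' i] and [y' j] are node coordinates. At a node [G]
     equals [h \o Phi], so [f - h] satisfies the homogeneous equation there. *)
  pose nodes := [set (x k.1, y k.2) | k in [set k : nat * nat | (k.1 <= N)%N && (k.2 <= M)%N]].
  have nodes_rect p : nodes p -> rect p.
    by move=> [k /andP[kN kM] <-]; exact: rect_node.
  have [C fhC] := within_continuous_bounded rect_compact (within_continuousB cf ch).
  move=> i j iN jM; apply/eqP; rewrite -hxy // -subr_eq0; apply/eqP.
  apply: (@cocycle_bounded_eq0 _ _ nodes Phi S (fun p => f p - h p) sigma C) => //.
  - move=> _ [k /andP[kN kM] <-]; rewrite /Phi /= Lx // Ky //.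
    have [p pN ->] := x'_node _ kN; have [q qM ->] := y'_node _ kM.
    by exists (p, q) => //=; rewrite pN qM.
  - by move=> p /nodes_rect /Ssigma.
  - by move=> p /nodes_rect /fhC.
  - move=> _ [k /andP[kN kM] <-]; rewrite fF; last exact: rect_node.
    have -> : Phi (x k.1, y k.2) = (x' k.1, y' k.2) by rewrite /Phi /= Lx // Ky.
    by rewrite Gxy //; ring.
  - by exists (i, j) => //=; rewrite iN jM.
(* The terms in [G] and [h] cancel in [f' - f], which is bounded on the compact rectangle and
   satisfies the homogeneous equation. *)
move=> f' [cf' _ /functional f'F] p rp; apply/eqP; rewrite -subr_eq0; apply/eqP.
have [C ffC] := within_continuous_bounded rect_compact (within_continuousB cf' cf).
apply: (@cocycle_bounded_eq0 _ _ rect Phi S (fun p => f' p - f p) sigma C) => //.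
by move=> q rq; rewrite f'F // fF //; ring.
Qed.
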